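(* The set $\mathcal T$ is $G(r,n)$-stable, and $$\mathcal T=\bigcup_{\zeta\in\mu_r^{n-1}}L_\zeta,\qquad L_\zeta:=\{(a,\zeta_2a,\dots,\zeta_na): a\in\mathbb{C}\}\quad(\zeta=(\zeta_2,\dots,\zeta_n)),$$ a union of $r^{n-1}$ lines through the origin, pairwise disjoint away from the origin, where they all meet. The group $G(r,n)$ acts transitively on the set of these $r^{n-1}$ lines.
   Context: Let $n,r\ge1$ be integers, $\mu_r$ the group of $r$-th roots of unity in $\mathbb{C}$, and $G(r,n)=\mu_r^n\rtimes S_n$ acting on $\mathbb{C}^n$ by $(\zeta_1,\dots,\zeta_n;\sigma)\cdot(x_1,\dots,x_n)=(\zeta_1x_{\sigma^{-1}(1)},\dots,\zeta_nx_{\sigma^{-1}(n)})$. Set $\mathcal T=\{x\in\mathbb{C}^n: x_1^r=x_2^r=\cdots=x_n^r\}$. *)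

(* Defs.v *)
From HB Require Import structures.
From mathcomp Require Import all_boot all_order all_algebra all_fingroup.
From mathcomp Require Import all_real_closed.
From mathcomp Require Import boolp classical_sets functions cardinality reals.

Set Implicit Arguments.
Unset Strict Implicit.
Unset Printing Implicit Defensive.

Import Order.TTheory GRing.Theory Num.Theory.
Local Open Scope classical_set_scope.
Local Open Scope ring_scope.

(* Positivity of r is a parameter because every element, including 0, is a
   0.-unity_root. *)
Record mu (R : realType) (r : nat) (hr : (0 < r)%N) := Mu {
  muval :> R[i];
  muvalP : r.-unity_root muval
}.

HB.instance Definition _ R r hr := [isSub for @muval R r hr].
HB.instance Definition _ R r hr := [Choice of @mu R r hr by <:].

Section MuGroup.
Variables (R : realType) (r : nat) (hr : (0 < r)%N).
Local Notation mu_r := (mu R hr).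

Lemma muE (z : mu_r) : (z : R[i]) ^+ r = 1.
Proof. exact/(unity_rootP (muvalP z)). Qed.

Lemma mu_neq0 (z : mu_r) : (z : R[i]) != 0.
Proof.
apply/eqP => z0; have := muE z; rewrite z0 expr0n eqn0Ngt hr /= => /eqP.
by rewrite eq_sym oner_eq0.
Qed.

Lemma mu1_subproof : r.-unity_root (1 : R[i]).
Proof. by apply/unity_rootP; rewrite expr1n. Qed.
Definition mu1 : mu_r := Mu hr mu1_subproof.

Lemma muM_subproof (x y : mu_r) : r.-unity_root ((x : R[i]) * y).
Proof. by apply/unity_rootP; rewrite exprMn !muE mulr1. Qed.
Definition muM (x y : mu_r) : mu_r := Mu hr (muM_subproof x y).

Lemma muV_subproof (x : mu_r) : r.-unity_root (x : R[i])^-1.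
Proof. by apply/unity_rootP; rewrite exprVn muE invr1. Qed.
Definition muV (x : mu_r) : mu_r := Mu hr (muV_subproof x).

Lemma muMA : associative muM.
Proof. by move=> x y z; apply: val_inj; rewrite /= mulrA. Qed.
Lemma mu1M : left_id mu1 muM.
Proof. by move=> x; apply: val_inj; rewrite /= mul1r. Qed.
Lemma muM1 : right_id mu1 muM.
Proof. by move=> x; apply: val_inj; rewrite /= mulr1. Qed.
Lemma muVM : left_inverse mu1 muV muM.
Proof. by move=> x; apply: val_inj; rewrite /= mulVf// mu_neq0. Qed.
Lemma muMV : right_inverse mu1 muV muM.
Proof. by move=> x; apply: val_inj; rewrite /= divff// mu_neq0. Qed.

HB.instance Definition _ := isGroup.Build mu_r muMA mu1M muM1 muVM muMV.

End MuGroup.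

(* The pair (zeta, sigma) is the element (zeta_1, ..., zeta_n; sigma). *)
Definition Grn (R : realType) (r n : nat) (hr : (0 < r)%N) : Type :=
  ({ffun 'I_n -> mu R hr} * 'S_n)%type.

HB.instance Definition _ R r n hr := Choice.on (@Grn R r n hr).

Section GrnGroup.
Variables (R : realType) (r n : nat) (hr : (0 < r)%N).
Local Notation G := (Grn R n hr).
Local Open Scope group_scope.

Definition Grn1 : G := ([ffun=> 1], 1).

(* In {perm T}, (s * t) i = t (s i): the composite "g.2 after h.2" is
   h.2 * g.2. *)
Definition GrnM (g h : G) : G :=
  ([ffun i => g.1 i * h.1 (g.2^-1 i)], h.2 * g.2).

Definition GrnV (g : G) : G := ([ffun i => (g.1 (g.2 i))^-1], g.2^-1).

Lemma GrnMA : associative GrnM.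
Proof.
move=> x y z; congr pair; last by rewrite /= mulgA.
by apply/ffunP => i; rewrite !ffunE /= mulgA invMg permM.
Qed.
Lemma Grn1M : left_id Grn1 GrnM.
Proof.
case=> x s; congr pair; last by rewrite /= mulg1.
by apply/ffunP => i; rewrite !ffunE /= mul1g invg1 perm1.
Qed.
Lemma GrnM1 : right_id Grn1 GrnM.
Proof.
case=> x s; congr pair; last by rewrite /= mul1g.
by apply/ffunP => i; rewrite !ffunE /= mulg1.
Qed.
Lemma GrnVM : left_inverse Grn1 GrnV GrnM.
Proof.
case=> x s; congr pair; last by rewrite /= mulgV.
by apply/ffunP => i; rewrite !ffunE /= invgK mulVg.
Qed.
Lemma GrnMV : right_inverse Grn1 GrnV GrnM.
Proof.
case=> x s; congr pair; last by rewrite /= mulVg.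
by apply/ffunP => i; rewrite !ffunE /= permKV mulgV.
Qed.

HB.instance Definition _ := isGroup.Build G GrnMA Grn1M GrnM1 GrnVM GrnMV.

End GrnGroup.

Section Action.
Variables (R : realType) (r n : nat) (hr : (0 < r)%N).
Local Notation G := (Grn R n hr).

Definition act (g : G) (x : 'rV[R[i]]_n) : 'rV[R[i]]_n :=
  \row_i ((g.1 i : R[i]) * x 0 ((g.2^-1)%g i)).

Lemma act1 (x : 'rV[R[i]]_n) : act 1%g x = x.
Proof. by apply/rowP => i; rewrite !mxE /= ffunE invg1 perm1 mul1r. Qed.

Lemma actM (g h : G) (x : 'rV[R[i]]_n) : act (g * h)%g x = act g (act h x).
Proof. by apply/rowP => i; rewrite !mxE /= ffunE invMg permM mulrA. Qed.

Definition stable (A : set 'rV[R[i]]_n) : Prop :=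
  forall g : G, act g @` A `<=` A.

(* Transitivity of the induced action A |-> act g @` A on a set F of subsets;
   the first clause says that this action does restrict to F. *)
Definition transitive_on (F : set (set 'rV[R[i]]_n)) : Prop :=
  (forall (g : G) A, F A -> F (act g @` A)) /\
  (forall A B, F A -> F B -> exists g : G, act g @` A = B).

End Action.

Definition calT (R : realType) (r n : nat) : set 'rV[R[i]]_n :=
  [set x | forall i j, x 0 i ^+ r = x 0 j ^+ r].

Arguments calT R r n : clear implicits.

(* zeta_2, ..., zeta_n are numbered by 'I_n.-1, so that zeta_(j.+2) is
   zeta j; unlift (Ordinal hn) i is None when i is the first index, and the
   predecessor of i otherwise. *)
Definition Lzeta (R : realType) (r n : nat) (hn : (0 < n)%N) (hr : (0 < r)%N)
    (zeta : {ffun 'I_n.-1 -> mu R hr}) : set 'rV[R[i]]_n :=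
  [set \row_i (if unlift (Ordinal hn) i is Some j then (zeta j : R[i]) * a
               else a) | a in [set: R[i]]].

Definition is_line (K : fieldType) (n : nat) (A : set 'rV[K]_n) : Prop :=
  exists2 U : {vspace 'rV[K]_n}, \dim U = 1%N & A = [set x | x \in U].

(* Main.v *)
Require Import Defs.
From mathcomp Require Import all_boot all_order all_algebra all_fingroup.
From mathcomp Require Import separable cyclotomic.
From mathcomp Require Import all_real_closed.
From mathcomp Require Import boolp classical_sets functions cardinality reals.

(** For [w] in [mu_r^n], let [ray w] be the line spanned by [w]. Multiplying [w]
by a scalar in [mu_r] does not change [ray w], so normalizing the first
coordinate to 1 shows that the lines [L_zeta] are exactly the lines [ray w],
and that they are determined by [zeta]. An element of [G(r,n)] maps [ray w] to
another line of this form; diagonal elements already act transitively. *)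

Set Implicit Arguments.
Unset Strict Implicit.
Unset Printing Implicit Defensive.

Import GRing.Theory Num.Theory.
Local Open Scope classical_set_scope.
Local Open Scope card_scope.
Local Open Scope ring_scope.

Lemma card_setT_bij (T U : Type) (f : T -> U) :
  bijective f -> [set: T] #= [set: U].
Proof.
move=> bij_f; have [g fK gK] := bij_f.
have <- : range f = [set: U] by apply/seteqP; split=> // y _; exists (g y).
by rewrite card_eq_sym inj_card_eq // => x y _ _; apply: bij_inj.
Qed.

Lemma card_setT_finType (T : finType) : [set: T] #= `I_#|T|.
Proof.
apply: (card_eq_trans (card_setT_bij (@enum_rank_bij T))).
by rewrite card_eq_sym; apply: card_II.
Qed.

Lemma bij_ffun (aT : finType) (rT sT : Type) (f : rT -> sT) :
  bijective f ->
  bijective (fun u : {ffun aT -> rT} => [ffun x => f (u x)] : {ffun aT -> sT}).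
Proof.
case=> g fK gK; exists (fun v : {ffun aT -> sT} => [ffun x => g (v x)]).
  by move=> u; apply/ffunP => x; rewrite !ffunE fK.
by move=> u; apply/ffunP => x; rewrite !ffunE gK.
Qed.

(** ['X^r - 1] splits over [F], and it is separable because [r] is nonzero in characteristic 0;
    hence its [r] roots are distinct. *)
Lemma unity_roots_enum (F : numClosedFieldType) (r : nat) : (0 < r)%N ->
  exists s : seq F, [/\ uniq s, size s = r & r.-unity_root =i s].
Proof.
move=> r_gt0; pose p : {poly F} := 'X^r - 1.
have [s ps] := closed_field_poly_normal p.
rewrite (monicP _) ?monicXnsubC // scale1r in ps.
have uniq_s : uniq s.
  by rewrite -separable_prod_XsubC -ps separable_Xn_sub_1 // pnatr_eq0 -lt0n.
(* The size of a polynomial is its degree plus one, hence the successor on both sides. *)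
have size_s : size s = r.
  by apply: succn_inj; rewrite -(size_prod_XsubC s id) -ps size_XnsubC.
by exists s; split=> // z; rewrite -[RHS]root_prod_XsubC -ps.
Qed.

Section Rays.
Variables (R : realType) (r n : nat) (hn : (0 < n)%N) (hr : (0 < r)%N).
Local Notation C := R[i].
Local Notation mu_r := (mu R hr).
Local Notation o := (Ordinal hn).

(** A root is sent to its position in the list of all roots. This reduces counting functions into
    [mu_r] to counting functions between finite types. *)
Lemma mu_bij_ord : exists f : mu_r -> 'I_r, bijective f.
Proof.
have [s [uniq_s size_s mem_s]] := @unity_roots_enum C r hr.
have idxP (z : mu_r) : (index (z : C) s < r)%N.
  by rewrite -{2}size_s index_mem -mem_s; apply: muvalP.
have nthP (i : 'I_r) : r.-unity_root s`_i.
  by rewrite -[_.-unity_root _]/(s`_i \in r.-unity_root) mem_s mem_nth ?size_s.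
exists (fun z => Ordinal (idxP z)); exists (fun i => Mu hr (nthP i)).
  by move=> z; apply: val_inj; rewrite /= nth_index // -mem_s; apply: muvalP.
by move=> i; apply: val_inj; rewrite /= index_uniq ?size_s.
Qed.

Lemma card_ffun_mu (m : nat) : [set: {ffun 'I_m -> mu_r}] #= `I_(r ^ m)%N.
Proof.
have [f bij_f] := mu_bij_ord.
apply: (card_eq_trans (card_setT_bij (bij_ffun 'I_m bij_f))).
by have := card_setT_finType {ffun 'I_m -> 'I_r}; rewrite card_ffun !card_ord.
Qed.

(** Here no coordinate is special, so permutations act directly on the index [w]; the price is that
    distinct [w] may give the same line. *)
Definition ray (w : 'I_n -> mu_r) : set 'rV[C]_n :=
  [set x | exists a, forall i, x 0 i = (w i : C) * a].

Lemma rayM (w : 'I_n -> mu_r) (c : mu_r) :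
  ray (fun i => w i * c)%g = ray w.
Proof.
apply/seteqP; split=> x [a xE].
  by exists ((c : C) * a) => i; rewrite xE mulrA.
by exists ((c : C)^-1 * a) => i; rewrite xE /= -mulrA mulVKf ?mu_neq0.
Qed.

Lemma image_act_ray (g : Grn R n hr) (w : 'I_n -> mu_r) :
  Defs.act g @` ray w = ray (fun i => g.1 i * w (g.2^-1 i))%g.
Proof.
apply/seteqP; split=> [_ [x [a xE] <-]|x [a xE]].
  by exists a => i; rewrite mxE xE mulrA.
exists (\row_i ((w i : C) * a)); first by exists a => i; rewrite mxE.
by apply/rowP => i; rewrite !mxE xE /= mulrA.
Qed.

Definition extend1 (zeta : {ffun 'I_n.-1 -> mu_r}) (i : 'I_n) : mu_r :=
  oapp zeta 1%g (unlift o i).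

Lemma extend1_first (zeta : {ffun 'I_n.-1 -> mu_r}) : extend1 zeta o = 1%g.
Proof. by rewrite /extend1 unlift_none. Qed.

Lemma extend1_lift (zeta : {ffun 'I_n.-1 -> mu_r}) (j : 'I_n.-1) :
  extend1 zeta (lift o j) = zeta j.
Proof. by rewrite /extend1 liftK. Qed.

Lemma Lzeta_ray (zeta : {ffun 'I_n.-1 -> mu_r}) :
  Lzeta hn zeta = ray (extend1 zeta).
Proof.
have E a i : (if unlift o i is Some j then (zeta j : C) * a else a)
    = (extend1 zeta i : C) * a.
  by rewrite /extend1; case: unliftP => //=; rewrite mul1r.
apply/seteqP; split=> [_ [a _ <-]|x [a xE]].
  by exists a => i; rewrite mxE E.
by exists a => //; apply/rowP => i; rewrite mxE E xE.
Qed.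

Lemma ray_Lzeta (w : 'I_n -> mu_r) :
  ray w = Lzeta hn [ffun j => w (lift o j) * (w o)^-1]%g.
Proof.
(* Dividing [w] by its first entry makes that entry 1. *)
rewrite Lzeta_ray -(rayM w (w o)^-1%g); congr ray; apply/funext => i.
case: (unliftP o i) => [j|] ->; first by rewrite extend1_lift ffunE.
by rewrite extend1_first mulgV.
Qed.

Lemma range_Lzeta : range (@Lzeta R r n hn hr) = range ray.
Proof.
apply/seteqP; split=> _ [z _ <-]; first by rewrite Lzeta_ray; exists (extend1 z).
by rewrite ray_Lzeta; eexists.
Qed.

Lemma Lzeta_zero (zeta : {ffun 'I_n.-1 -> mu_r}) : Lzeta hn zeta 0.
Proof. by rewrite Lzeta_ray; exists 0 => i; rewrite mxE mulr0. Qed.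

(** The first coordinate of [x] is its parameter on both lines. This common parameter is nonzero
    since [x] is, so it cancels from the other coordinates. *)
Lemma Lzeta_meet (zeta xi : {ffun 'I_n.-1 -> mu_r}) (x : 'rV[C]_n) :
  x != 0 -> Lzeta hn zeta x -> Lzeta hn xi x -> zeta = xi.
Proof.
rewrite !Lzeta_ray => x_neq0 [a xa] [b xb].
have eq_ab : a = b.
  by have := xa o; rewrite xb !extend1_first !mul1r.
have a_neq0 : a != 0.
  by apply: contraNneq x_neq0 => a0; apply/eqP/rowP => i; rewrite xa a0 mulr0 mxE.
apply/ffunP => j; apply: val_inj; apply: (mulIf a_neq0).
by rewrite /= -!(extend1_lift _ j) -xa xb eq_ab.
Qed.

Lemma Lzeta_inj : injective (@Lzeta R r n hn hr).
Proof.
(* The point of parameter 1 is a nonzero point common to both lines, so [Lzeta_meet] applies. *)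
move=> zeta xi eqL; pose x : 'rV[C]_n := \row_i (extend1 zeta i : C).
have Lx : Lzeta hn zeta x.
  by rewrite Lzeta_ray; exists 1 => i; rewrite mxE mulr1.
apply: (@Lzeta_meet _ _ x) => //; last by rewrite -eqL.
by apply/eqP => /rowP /(_ o); rewrite !mxE; apply/eqP/mu_neq0.
Qed.

Lemma is_line_ray (w : 'I_n -> mu_r) : is_line (ray w).
Proof.
pose v : 'rV[C]_n := \row_i (w i : C).
have v_neq0 : v != 0.
  by apply/eqP => /rowP /(_ o); rewrite !mxE; apply/eqP/mu_neq0.
exists <[v]>%VS; first by rewrite dim_vline v_neq0.
apply/seteqP; split=> x /=.
  by case=> a xE; apply/vlineP; exists a; apply/rowP => i; rewrite !mxE xE mulrC.
by case/vlineP => a ->; exists a => i; rewrite !mxE mulrC.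
Qed.

Lemma calT_bigcup_ray : calT R r n = \bigcup_(w in [set: 'I_n -> mu_r]) ray w.
Proof.
apply/seteqP; split=> [x Tx|x [w _ [a xE]] i j]; last first.
  by rewrite !xE !exprMn !muE.
have [xo0|xo_neq0] := eqVneq (x 0 o) 0.
  (* All [r]-th powers vanish here, so [x] is 0 and lies on every ray; the constant 1 is an
     arbitrary choice. *)
  exists (fun=> 1%g) => //; exists 0 => i; rewrite mulr0.
  by have /eqP := Tx i o; rewrite xo0 expr0n eqn0Ngt hr expf_eq0 hr => /eqP.
(* Equal [r]-th powers make the ratios to the first coordinate roots of unity; they serve as [w],
   with parameter [x 0 o]. *)
have wP i : r.-unity_root (x 0 i / x 0 o).
  by apply/unity_rootP; rewrite exprMn exprVn (Tx i o) divff ?expf_neq0.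
by exists (fun i => Mu hr (wP i)) => //; exists (x 0 o) => i; rewrite /= divfK.
Qed.

Lemma stable_calT : stable hr (calT R r n).
Proof.
by move=> g _ [x Tx <-] i j; rewrite !mxE !exprMn !muE !mul1r; apply: Tx.
Qed.

Lemma transitive_on_rays : transitive_on hr (range ray).
Proof.
split=> [g _ [w _ <-]|_ _ [w _ <-] [z _ <-]].
  by rewrite image_act_ray; eexists.
(* The diagonal element with entries [z i / w i] carries [w] to [z]. *)
exists ([ffun i => z i * (w i)^-1], 1)%g; rewrite image_act_ray; congr ray.
by apply/funext => i; rewrite /= ffunE invg1 perm1 mulgKV.
Qed.

End Rays.

Theorem proposition7p2 (R : realType) (n r : nat)
    (hn : (0 < n)%N) (hr : (0 < r)%N) :
  stable hr (calT R r n) /\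
  calT R r n = \bigcup_(zeta in [set: {ffun 'I_n.-1 -> mu R hr}]) Lzeta hn zeta /\
  (forall zeta : {ffun 'I_n.-1 -> mu R hr}, is_line (Lzeta hn zeta)) /\
  range (@Lzeta R r n hn hr) #= `I_(r ^ n.-1)%N /\
  (forall zeta : {ffun 'I_n.-1 -> mu R hr}, Lzeta hn zeta 0) /\
  trivIset [set: {ffun 'I_n.-1 -> mu R hr}] (fun zeta => Lzeta hn zeta `\ 0) /\
  transitive_on hr (range (@Lzeta R r n hn hr)).
Proof.
split; first exact: stable_calT.
split.
  rewrite (calT_bigcup_ray R hn hr); apply/seteqP; split=> x [w _].
    by rewrite (ray_Lzeta hn) => Lx; eexists; last exact: Lx.
  by rewrite Lzeta_ray => rx; exists (extend1 hn w).
split; first by move=> zeta; rewrite Lzeta_ray; exact: (is_line_ray hn).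
split.
  (* Distinct [zeta] give distinct lines, so counting the lines amounts to counting the indices. *)
  apply: card_eq_trans (card_ffun_mu R hr n.-1).
  by apply: inj_card_eq => zeta xi _ _; apply: Lzeta_inj.
split; first exact: Lzeta_zero.
split; last by rewrite range_Lzeta; apply: transitive_on_rays.
by move=> zeta xi _ _ [x [[Lx /eqP x_neq0] [Lx' _]]]; apply: Lzeta_meet Lx Lx'.
Qed.
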